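(* For every irrational $\alpha=[a_1,a_2,\dots]\in(0,1)$ and every integer $n\ge 1$ with $\mathrm{ord}(n)=N$, $$\sup_{\beta\in(0,1)}|S_n(\alpha,\beta)|\le |S_n(\alpha)|+6\sum_{m=1}^{N}\Big(3+\frac{a_m}{4}\Big).$$
   Context: $[a_1,a_2,\dots]=1/(a_1+1/(a_2+\cdots))$ with positive integers $a_h$; $q_n$ is the denominator of the convergent $[a_1,\dots,a_n]$: $q_0=1$, $q_1=a_1$, $q_{n+1}=a_{n+1}q_n+q_{n-1}$. $\{\cdot\}$ is the fractional part. Put $s(y):=2\chi_{[0,1/2)}(\{y\})-1$, $S_n(\alpha,\beta):=\sum_{r=0}^{n}s(r\alpha+\beta)$ and $S_n(\alpha):=S_n(\alpha,0)$. Order of an integer: every positive integer $r$ can be written uniquely as $r=\sum_{h=0}^N c_hq_h$ (Ostrowski representation) with integers $0\le c_0\le a_1-1$, $0\le c_h\le a_{h+1}$ for $h\ge1$, $c_{h-1}=0$ whenever $c_h=a_{h+1}$ ($h\ge1$), and $c_N>0$; then $\mathrm{ord}(r):=N$. An empty sum is $0$. *)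

(* Defs.v *)
From mathcomp Require Import all_boot all_order all_algebra.
From mathcomp Require Import all_classical all_reals all_analysis.

Set Implicit Arguments.
Unset Strict Implicit.
Unset Printing Implicit Defensive.

Import Order.TTheory GRing.Theory Num.Theory.
Import numFieldNormedType.Exports.

Local Open Scope classical_set_scope.
Local Open Scope ring_scope.

(* Partial quotients are sequences a : nat -> nat indexed from 1; the value
   a 0 is never used. *)

Fixpoint finite_cf (R : realType) (s : seq nat) : R :=
  if s is x :: s' then (x%:R + finite_cf R s')^-1 else 0.

Definition cf_convergent (R : realType) (a : nat -> nat) (n : nat) : R :=
  finite_cf R [seq a h | h <- iota 1 n].

Definition is_cf_expansion (R : realType) (a : nat -> nat) (alpha : R) : Prop :=
  (forall h : nat, (1 <= h)%N -> (0 < a h)%N) /\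
  cf_convergent R a @ \oo --> alpha.

Fixpoint cf_q (a : nat -> nat) (n : nat) : nat :=
  if n is n'.+1 then
    if n' is n''.+1 then (a n * cf_q a n' + cf_q a n'')%N else a 1%N
  else 1%N.

Definition ostrowski_rep (a : nat -> nat) (r N : nat) (c : nat -> nat) : Prop :=
  [/\ r = (\sum_(0 <= h < N.+1) c h * cf_q a h)%N,
      (c 0 < a 1)%N,
      (forall h : nat, (1 <= h <= N)%N -> (c h <= a h.+1)%N),
      (forall h : nat, (1 <= h <= N)%N -> c h = a h.+1 -> c h.-1 = 0%N)
    & (0 < c N)%N].

Definition has_ord (a : nat -> nat) (r N : nat) : Prop :=
  exists c : nat -> nat, ostrowski_rep a r N c.

Definition frac_part (R : realType) (y : R) : R := y - (Num.floor y)%:~R.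

Definition square_wave (R : realType) (y : R) : R :=
  2 * \1_(`[0, 2^-1[%classic : set R) (frac_part y) - 1.

Definition birkhoff_sum (R : realType) (n : nat) (alpha beta : R) : R :=
  \sum_(0 <= r < n.+1) square_wave (r%:R * alpha + beta).

(* Main.v *)
Require Import Defs.
From mathcomp Require Import all_boot all_order all_algebra.
From mathcomp Require Import all_classical all_reals all_analysis.
From mathcomp Require Import ring lra zify.

Set Implicit Arguments.
Unset Strict Implicit.
Unset Printing Implicit Defensive.

Import Order.TTheory GRing.Theory Num.Theory.
Import numFieldNormedType.Exports.

Local Open Scope classical_set_scope.
Local Open Scope ring_scope.

(** Write [W b k] for the sum of the first [k] values of the square wave along
the rotation by [alpha] started at [b], and let [p / q] be a convergent of
[alpha], with next denominator [q'].

The heart of the proof is a renormalisation ([wave_sum_renorm]): as long as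
[c * q <= q'], the sum [W b (c * q)] is within 2 of zero for even [q], and
within 2 of a square-wave sum of only [c] terms, for the rotation by
[theta = q * (q * alpha - p)], for odd [q].  Indeed the square wave is
[1 + 2 * (floor y - floor (y + 1/2))].  Replacing [alpha] by [p / q] inside each
block of [q] consecutive terms turns the block into a sum over the [q]-th parts
of the circle, which Hermite's identity evaluates ([sum_square_wave_grid]).  The
price of the replacement is counted by the points that pass an integer while
they drift; by Hermite's identity again all blocks together see at most one
such passage, since the total drift is at most [1 / q].  The same count for
[y + 1/2] enters with the opposite sign, so that the error is at most 2.

Since [c * |theta| <= 1], the short sum is elementary: its points are
[|theta|]-separated on the circle, hence none of its translates puts more
points in a half circle than the orbit started at 0 ([card_on_crest_le]).  For
negative [theta] the orbit is read backwards and one value at a jump is lost.  So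
[|W b (c * q)|] is at most [|W 0 (c * q)| + 6] ([wave_sum_block_near0]).

This handles the leading Ostrowski digit, which is not paid for by the right
hand side.  For the other digits a bound on the sum itself is enough: with
[a] the partial quotient, [|W b (c * q)|] is at most [2 + c] by renormalisation,
and at most [8 + (a - c)] because it is the sum over the next denominator,
minus [a - c] blocks, minus the sum over the previous denominator, the first
and last of these being at most 3.  Averaging gives [5 + a / 2]
([wave_sum_level]).  Splitting [n + 1] as leading digit, lower digits and one
more term, and comparing [b] with 0, costs
[6 + 2 + 2 * sum (5 + a_m / 2) <= sum (18 + 3 / 2 * a_m)] when there is at least
one lower digit.  Otherwise [n < a_1], and the separation argument applies
directly to [alpha], without any loss. *)

(** * Summing the square wave over rational grids *)

Lemma floorD_int (R : realType) (y : R) (z : int) :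
  Num.floor (y + z%:~R) = Num.floor y + z.
Proof. by rewrite floorDrz ?intr_int // intrKfloor. Qed.

(** An increment of [floor y] is a passage from trough to crest, one of
[floor (y + 1/2)] a passage from crest to trough: this turns the wave into
functions that are monotone along a drift. *)
Lemma square_waveE (R : realType) (y : R) :
  square_wave y
  = 1 + 2 * ((Num.floor y)%:~R - (Num.floor (y + 2^-1))%:~R).
Proof.
rewrite /square_wave /frac_part indicE.
have /andP[fy yf] := floor_itv y.
rewrite intrD in yf.
case: (ltP (y - (Num.floor y)%:~R) (2^-1)) => h.
- have -> : Num.floor (y + 2^-1) = Num.floor y.
    by apply: floor_def; rewrite intrD; lra.
  rewrite mem_set; last by rewrite /= in_itv /=; lra.
  by rewrite subrr /=; lra.
- have -> : Num.floor (y + 2^-1) = Num.floor y + 1.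
    by apply: floor_def; rewrite !intrD; lra.
  rewrite memNset; last by rewrite /= in_itv /= => /andP[_]; lra.
  by rewrite /= intrD; lra.
Qed.

Lemma square_wave_half (R : realType) (y : R) :
  square_wave (y + 2^-1) = - square_wave y.
Proof.
rewrite !square_waveE.
have -> : y + 2^-1 + 2^-1 = y + 1%:~R by lra.
by rewrite floorD_int intrD; lra.
Qed.

Lemma square_wave_int (R : realType) (y : R) (z : int) :
  square_wave (y + z%:~R) = square_wave y.
Proof.
by rewrite /square_wave /frac_part floorD_int intrD opprD addrACA subrr addr0.
Qed.

Lemma square_wave_norm (R : realType) (y : R) : `|square_wave y| = 1.
Proof.
rewrite /square_wave indicE; case: (_ \in _) => /=.
- by rewrite mulr1 (_ : 2 - 1 = 1) ?normr1 //; lra.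
- by rewrite mulr0 sub0r normrN1.
Qed.

Lemma floor_grid (R : realType) (q : nat) (m : int) (x : R) : (0 < q)%N ->
  Num.floor (x + m%:~R / q%:R)
  = ((Num.floor (q%:R * x) + m) %/ q%:Z)%Z.
Proof.
move=> q0; have q0R : 0 < q%:R :> R by rewrite ltr0n.
set f := Num.floor (q%:R * x).
have /andP[] := floor_itv (q%:R * x); rewrite -/f intrD => fx xf.
have E := divz_eq (f + m) q%:Z.
have r0 : (0 <= (f + m) %% q%:Z)%Z by rewrite modz_ge0 //; lia.
have rq : ((f + m) %% q%:Z < q%:Z)%Z by rewrite ltz_pmod //; lia.
move: E r0 rq; set d := (_ %/ _)%Z; set r := (_ %% _)%Z => E r0 rq.
have ER : f%:~R + m%:~R = d%:~R * q%:R + r%:~R :> R.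
  by rewrite -intrD E intrD intrM.
have r0R : 0 <= r%:~R :> R by rewrite ler0z.
have rqR : r%:~R + 1 <= q%:R :> R.
  have -> : q%:R = q%:Z%:~R :> R by [].
  by rewrite -(intrD _ r 1) ler_int; lia.
have -> : x + m%:~R / q%:R = (q%:R * x + m%:~R) / q%:R.
  by rewrite mulrDl mulrAC divff ?mul1r // gt_eqF.
apply: floor_def; rewrite intrD ler_pdivlMr // ltr_pdivrMr // mulrDl.
by apply/andP; split; lra.
Qed.

(** [r |-> m + r * p] permutes the residues modulo [q]. *)
Lemma residue_sum (q p : nat) (m : int) : (0 < q)%N -> coprime q p ->
  \sum_(r < q) ((m + (r * p)%N%:Z) %% q%:Z)%Z = \sum_(r < q) r%:Z.
Proof.
move=> q0 cop; have q0Z : q%:Z != 0 by lia.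
pose res (r : 'I_q) : int := ((m + (r * p)%N%:Z) %% q%:Z)%Z.
have res_ge0 r : 0 <= res r by rewrite modz_ge0.
have res_lt r : (`|res r| < q)%N.
  have : res r < q%:Z by rewrite ltz_pmod //; lia.
  by have := res_ge0 r; lia.
pose perm r : 'I_q := Ordinal (res_lt r).
have perm_inj : injective perm.
  move=> r s /(congr1 val) /= /eqP.
  have -> : (`|res r|%N == `|res s|%N) = (res r == res s).
    by have := res_ge0 r; have := res_ge0 s; lia.
  wlog sr : r s / (s <= r)%N => [th E|].
    case: (leqP s r) => [|/ltnW] sr; first exact: th.
    by apply/esym/th; rewrite // eq_sym.
  rewrite /res eqz_mod_dvd.
  have -> : m + (r * p)%N%:Z - (m + (s * p)%N%:Z) = ((r - s) * p)%N%:Z.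
    by rewrite mulnBl; have := leq_mul sr (leqnn p); lia.
  rewrite dvdzE /= Gauss_dvdl // => /dvdnP[k Hk].
  have rq := ltn_ord r; apply/val_inj => /=.
  case: k Hk => [|k]; first by lia.
  by rewrite mulSn; lia.
rewrite [RHS](reindex_inj perm_inj) /=.
by apply: eq_bigr => r _; rewrite /= gez0_abs.
Qed.

(** Hermite's identity up to its additive constant, which is all that differences
of such sums need.  Summing the Euclidean divisions of [floor (q * z) + r * p]
by [q], the remainders contribute an amount independent of [z]. *)
Lemma sum_floor_grid (R : realType) (q p : nat) (x y : R) :
  (0 < q)%N -> coprime q p ->
  \sum_(r < q) Num.floor (x + (r * p)%N%:R / q%:R) - Num.floor (q%:R * x)
  = \sum_(r < q) Num.floor (y + (r * p)%N%:R / q%:R) - Num.floor (q%:R * y).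
Proof.
move=> q0 cop.
suff key (z : R) : q%:Z * (\sum_(r < q) Num.floor (z + (r * p)%N%:R / q%:R)
    - Num.floor (q%:R * z)) = \sum_(r < q) (r * p)%N%:Z - \sum_(r < q) r%:Z.
  have := key x; rewrite -(key y) => /mulfI; apply; lia.
set f := Num.floor (q%:R * z).
have grid r : Num.floor (z + (r * p)%N%:R / q%:R) = ((f + (r * p)%N%:Z) %/ q%:Z)%Z.
  exact: (floor_grid (r * p)%N%:Z z q0).
under eq_bigr => r _ do rewrite grid.
rewrite -(residue_sum f q0 cop) mulrBr mulr_sumr.
have -> : \sum_(r < q) q%:Z * ((f + (r * p)%N%:Z) %/ q%:Z)%Z =
   \sum_(r < q) ((f + (r * p)%N%:Z) - ((f + (r * p)%N%:Z) %% q%:Z)%Z).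
  by apply: eq_bigr => r _; rewrite {2}(divz_eq (f + (r * p)%N%:Z) q%:Z) addrK mulrC.
rewrite sumrB big_split /= sumr_const card_ord -mulr_natl natz.
ring.
Qed.

(** By Hermite's identity the sum depends on [floor (q * y)] and
[floor (q * y + q / 2)] only; for odd [q] these are, up to a constant, the
two floors that make up the wave at [q * y], for even [q] they differ by a
constant. *)
Lemma sum_square_wave_grid (R : realType) (q p : nat) (y : R) :
  (0 < q)%N -> coprime q p ->
  \sum_(r < q) square_wave (y + (r * p)%N%:R / q%:R)
  = if odd q then square_wave (q%:R * y) else 0.
Proof.
move=> q0 cop.
under eq_bigr => r _ do rewrite square_waveE addrAC.
rewrite big_split /= sumr_const card_ord -mulr_sumr sumrB -!(raddf_sum (intmul 1)) /=.
have := sum_floor_grid y (y + 2^-1) q0 cop.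
set A := \sum_(r < q) Num.floor (y + _); set B := \sum_(r < q) _ => E.
have -> : A%:~R - B%:~R = (Num.floor (q%:R * y))%:~R
    - (Num.floor (q%:R * (y + 2^-1)))%:~R :> R.
  by rewrite -!intrB; congr (_%:~R); lia.
have Eq := odd_double_half q.
have EqR : q%:R = (odd q)%:R + (q./2)%:R *+ 2 :> R by rewrite -mulrnA muln2 -natrD Eq.
rewrite square_waveE; case: (odd q) EqR => EqR.
  have -> : q%:R * (y + 2^-1) = (q%:R * y + 2^-1) + (q./2)%:Z%:~R.
    by rewrite -pmulrn; move: EqR => /=; lra.
  by rewrite floorD_int intrD -pmulrn; move: EqR => /=; lra.
have -> : q%:R * (y + 2^-1) = q%:R * y + (q./2)%:Z%:~R.
  by rewrite -pmulrn; move: EqR => /=; lra.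
by rewrite floorD_int intrD -pmulrn; move: EqR => /=; lra.
Qed.

(** * Renormalisation of blocks *)

Definition wave_sum (R : realType) (theta y : R) (k : nat) : R :=
  \sum_(j < k) square_wave (j%:R * theta + y).

(** Within the [j]-th block the increment of [F] is at most the increment over the
whole block, and the latter telescope. *)
Lemma drift_telescope (R : realType) (F : R -> int) (d : R) (q c r : nat) :
  {homo F : x y / x <= y} -> 0 <= d -> (r <= q)%N ->
  0 <= \sum_(j < c) (F ((j * q + r)%N%:R * d) - F ((j * q)%N%:R * d))
    <= F ((c * q)%N%:R * d) - F 0.
Proof.
move=> Fle d0 rq.
have mono i k : (i <= k)%N -> F (i%:R * d) <= F (k%:R * d).
  by move=> ik; apply: Fle; rewrite ler_wpM2r // ler_nat.
elim: c => [|c /andP[IH1 IH2]]; first by rewrite big_ord0 mul0n mul0r subrr lexx.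
rewrite big_ord_recr /=.
have h1 := mono _ _ (leq_addr r (c * q)).
have h2 : F ((c * q + r)%N%:R * d) <= F ((c.+1 * q)%N%:R * d).
  by apply: mono; rewrite mulSn addnC leq_add2r.
by apply/andP; split; lra.
Qed.

(** The number of integers passed, with sign, while in each block the points of the
rational grid at its start drift to the points of the orbit. *)
Definition floor_defect (R : realType) (alpha : R) (p q c : nat) (b : R) : int :=
  \sum_(j < c) \sum_(r < q)
    (Num.floor ((j * q + r)%N%:R * alpha + b)
     - Num.floor ((j * q)%N%:R * alpha + b + (r * p)%N%:R / q%:R)).

(** Up to integers, the orbit splits into [q] residue classes, each of which
moves at constant speed from its grid point. *)
Lemma floor_defect_drift (R : realType) (alpha b : R) (p q c : nat) :
  (0 < q)%N ->
  floor_defect alpha p q c b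
  = \sum_(r < q) \sum_(j < c)
     (Num.floor (b + (r * p)%N%:R / q%:R + (j * q + r)%N%:R * (alpha - p%:R / q%:R))
      - Num.floor (b + (r * p)%N%:R / q%:R + (j * q)%N%:R * (alpha - p%:R / q%:R))).
Proof.
move=> q0; have q0R : q%:R != 0 :> R by rewrite pnatr_eq0 -lt0n.
rewrite /floor_defect exchange_big /=; apply: eq_bigr => r _; apply: eq_bigr => j _.
have -> : (j * q + r)%N%:R * alpha + b = (b + (r * p)%N%:R / q%:R
    + (j * q + r)%N%:R * (alpha - p%:R / q%:R)) + (j * p)%N%:Z%:~R.
  by rewrite -pmulrn !natrD !natrM; field.
have -> : (j * q)%N%:R * alpha + b + (r * p)%N%:R / q%:R = (b + (r * p)%N%:R / q%:R
    + (j * q)%N%:R * (alpha - p%:R / q%:R)) + (j * p)%N%:Z%:~R.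
  by rewrite -pmulrn !natrM; field.
by rewrite !floorD_int; lia.
Qed.

Lemma floorD_le1 (R : realType) (x y : R) : y <= x + 1 ->
  Num.floor y - Num.floor x <= 1.
Proof.
have -> : x + 1 = x + 1%:~R by [].
by move/le_floor; rewrite floorD_int; lia.
Qed.

(** Telescoping bounds each residue class by its total drift; by Hermite's
identity the total over all classes is the increment of [floor] along a segment
of length at most 1.  The sign of the drift, which is not known here, decides
between [m = 0] and [m = -1]; only that [m] does not depend on [b] matters. *)
Lemma floor_defect_bound (R : realType) (alpha : R) (p q c : nat) :
  (0 < q)%N -> coprime q p ->
  (c * q)%N%:R * `|q%:R * alpha - p%:R| <= 1 ->
  exists m : int, forall b, m <= floor_defect alpha p q c b <= m + 1.
Proof.
move=> q0 cop; have q0R : 0 < q%:R :> R by rewrite ltr0n.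
set d := alpha - p%:R / q%:R.
have -> : q%:R * alpha - p%:R = q%:R * d.
  by rewrite /d mulrBr mulrCA divff ?mulr1 // gt_eqF.
move=> small.
have total b : \sum_(r < q) (Num.floor (b + (r * p)%N%:R / q%:R + (c * q)%N%:R * d)
     - Num.floor (b + (r * p)%N%:R / q%:R))
   = Num.floor (q%:R * (b + (c * q)%N%:R * d)) - Num.floor (q%:R * b).
  rewrite sumrB; under eq_bigr => r _ do rewrite addrAC.
  by have := sum_floor_grid b (b + (c * q)%N%:R * d) q0 cop; lra.
case: (leP 0 d) => d0; [exists 0|exists (-1)] => b; rewrite floor_defect_drift // -/d.
- pose F (r : nat) (t : R) := Num.floor (b + (r * p)%N%:R / q%:R + t).
  have Fle r : {homo F r : x y / x <= y}.
    by move=> x y xy; apply: le_floor; rewrite lerD2l.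
  have tel (r : 'I_q) := @drift_telescope R (F r) d q c r (Fle r) d0 (ltnW (ltn_ord r)).
  apply/andP; split; first by apply: sumr_ge0 => r _; have /andP[] := tel r.
  apply: (@le_trans _ _ (\sum_(r < q) (F r ((c * q)%N%:R * d) - F r 0))).
    by apply: ler_sum => r _; have /andP[] := tel r.
  rewrite /F; under eq_bigr => r _ do rewrite addr0.
  rewrite total add0r; apply: floorD_le1.
  by rewrite mulrDr lerD2l mulrCA (le_trans _ small) // ler_wpM2l // ler_norm.
- (* Leftward drift: both signs are reversed to make [F] nondecreasing. *)
  pose F (r : nat) (t : R) := - Num.floor (b + (r * p)%N%:R / q%:R - t).
  have Fle r : {homo F r : x y / x <= y}.
    by move=> x y xy; rewrite lerN2; apply: le_floor; rewrite lerD2l lerN2.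
  have d0' : 0 <= - d by lra.
  have tel (r : 'I_q) := @drift_telescope R (F r) (- d) q c r (Fle r) d0' (ltnW (ltn_ord r)).
  have E : \sum_(r < q) \sum_(j < c)
     (Num.floor (b + (r * p)%N%:R / q%:R + (j * q + r)%N%:R * d)
      - Num.floor (b + (r * p)%N%:R / q%:R + (j * q)%N%:R * d))
     = - \sum_(r < q) \sum_(j < c)
     (F r ((j * q + r)%N%:R * - d) - F r ((j * q)%N%:R * - d)).
    rewrite -sumrN; apply: eq_bigr => r _; rewrite -sumrN; apply: eq_bigr => j _.
    by rewrite /F !mulrN !opprK; ring.
  rewrite E lerN2 addNr oppr_le0; apply/andP; split; last first.
    by apply: sumr_ge0 => r _; have /andP[] := tel r.
  apply: (@le_trans _ _ (\sum_(r < q) (F r ((c * q)%N%:R * - d) - F r 0))).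
    by apply: ler_sum => r _; have /andP[] := tel r.
  have -> : \sum_(r < q) (F r ((c * q)%N%:R * - d) - F r 0) =
    - \sum_(r < q) (Num.floor (b + (r * p)%N%:R / q%:R + (c * q)%N%:R * d)
     - Num.floor (b + (r * p)%N%:R / q%:R)).
    rewrite -sumrN; apply: eq_bigr => r _.
    by rewrite /F subr0 mulrN !opprK; ring.
  rewrite total opprB; apply: floorD_le1.
  have : (c * q)%N%:R * (q%:R * - d) <= 1.
    by apply: le_trans small; rewrite ler_wpM2l // mulrN -normrN ler_norm.
  by rewrite mulrCA; lra.
Qed.

Lemma wave_sum_blocks (R : realType) (alpha b : R) (p q c : nat) :
  wave_sum alpha b (c * q)
  = \sum_(j < c) \sum_(r < q) square_wave ((j * q)%N%:R * alpha + b + (r * p)%N%:R / q%:R)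
    + 2 * (floor_defect alpha p q c b - floor_defect alpha p q c (b + 2^-1))%:~R.
Proof.
have -> : wave_sum alpha b (c * q)
    = \sum_(j < c) \sum_(r < q) square_wave ((j * q + r)%N%:R * alpha + b).
  rewrite /wave_sum.
  elim: c => [|c IH]; first by rewrite mul0n !big_ord0.
  rewrite big_ord_recr /= -IH mulSn addnC big_split_ord /=.
  by congr (_ + _).
rewrite /floor_defect intrB !(raddf_sum (intmul 1)) /= mulrBr !mulr_sumr -sumrB -big_split /=.
apply: eq_bigr => j _; rewrite !(raddf_sum (intmul 1)) /= !mulr_sumr -sumrB -big_split /=.
apply: eq_bigr => r _; rewrite !square_waveE !intrB.
have -> : (j * q + r)%N%:R * alpha + (b + 2^-1) = (j * q + r)%N%:R * alpha + b + 2^-1.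
  by rewrite addrA.
have -> : (j * q)%N%:R * alpha + (b + 2^-1) + (r * p)%N%:R / q%:R
   = (j * q)%N%:R * alpha + b + (r * p)%N%:R / q%:R + 2^-1 by lra.
by ring.
Qed.

(** Both floors of [square_waveE] have a defect among the same two consecutive
integers, so their difference is at most 1 in absolute value. *)
Lemma wave_sum_renorm (R : realType) (alpha b : R) (p q c : nat) :
  (0 < q)%N -> coprime q p ->
  (c * q)%N%:R * `|q%:R * alpha - p%:R| <= 1 ->
  `|wave_sum alpha b (c * q)
    - (if odd q then wave_sum (q%:R * (q%:R * alpha - p%:R)) (q%:R * b) c else 0)|
  <= 2.
Proof.
move=> q0 cop small.
have [m Hm] := floor_defect_bound q0 cop small.
rewrite (wave_sum_blocks alpha b p).
under eq_bigr => j _ do rewrite sum_square_wave_grid //.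
set S := \sum_(j < c) _; set T := (if _ then _ else _).
have -> : S = T.
  rewrite /S /T /wave_sum; case: (odd q); last by rewrite big1_eq.
  apply: eq_bigr => j _; rewrite -[RHS](square_wave_int _ (j * q * p)%N%:Z) -!pmulrn.
  by congr square_wave; rewrite !natrM; ring.
have : `|floor_defect alpha p q c b - floor_defect alpha p q c (b + 2^-1)| <= 1.
  by have := Hm b; have := Hm (b + 2^-1); lia.
rewrite -(ler_int R) intr_norm (addrC T) addrK normrM (ger0_norm (ler0n _ 2)).
by lra.
Qed.

(** * Sums for a small rotation *)

Definition on_crest (R : realType) (theta y : R) (c : nat) : {set 'I_c} :=
  [set j : 'I_c | frac_part (j%:R * theta + y) < 2^-1].

Lemma frac_part_itv (R : realType) (y : R) : 0 <= frac_part y < 1.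
Proof.
rewrite /frac_part; have := floor_itv y; rewrite intrD => /andP[].
by move=> ? ?; apply/andP; split; lra.
Qed.

Lemma frac_part_id (R : realType) (y : R) : 0 <= y < 1 -> frac_part y = y.
Proof.
move=> y01; rewrite /frac_part (@floor_def _ _ 0) ?subr0 //.
Qed.

Lemma square_wave_crest (R : realType) (y : R) :
  square_wave y = 2 * (frac_part y < 2^-1)%R%:R - 1.
Proof.
have /andP[y0 _] := frac_part_itv y.
rewrite /square_wave indicE; congr (2 * (nat_of_bool _)%:R - 1).
by apply/idP/idP; rewrite inE /= in_itv /= y0.
Qed.

Lemma wave_sum_crest (R : realType) (theta y : R) (c : nat) :
  wave_sum theta y c = 2 * #|on_crest theta y c|%:R - c%:R.
Proof.
rewrite /wave_sum; under eq_bigr => j _ do rewrite square_wave_crest.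
rewrite sumrB -mulr_sumr sumr_const card_ord; congr (2 * _ - _).
rewrite -sum1_card natr_sum [RHS]big_mkcond /=.
by apply: eq_bigr => j _; rewrite inE; case: ifP.
Qed.

(** Two points differ by [(j - i) * theta] modulo 1, which lies between [theta] and
[1 - theta]. *)
Lemma frac_part_spacing (R : realType) (theta y : R) (c i j : nat) :
  0 < theta -> c%:R * theta <= 1 -> (i < j < c)%N ->
  theta <= `|frac_part (j%:R * theta + y) - frac_part (i%:R * theta + y)|.
Proof.
move=> t0 ct /andP[ij jc]; rewrite /frac_part.
set z := Num.floor (j%:R * theta + y); set w := Num.floor (i%:R * theta + y).
have h1 : theta <= (j%:R - i%:R) * theta.
  rewrite ler_peMl ?(ltW t0) // -natrB ?ler1n ?subn_gt0 //.
  exact: ltnW.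
have h2 : (j%:R - i%:R) * theta <= 1 - theta.
  have : (j.+1 - i)%N%:R * theta <= 1.
    by apply: le_trans ct; rewrite ler_wpM2r ?(ltW t0) // ler_nat; lia.
  by rewrite natrB; [rewrite -addn1 natrD; lra | lia].
case: (leP z w) => zw.
  apply: le_trans (ler_norm _).
  have : z%:~R <= w%:~R :> R by rewrite ler_int.
  by lra.
rewrite -normrN; apply: le_trans (ler_norm _).
have : w%:~R + 1 <= z%:~R :> R by rewrite -[1]/(1%:~R) -intrD ler_int; lia.
by lra.
Qed.

(** Cut the half circle into slots of length [theta], numbered from 0.  By spacing,
each slot contains at most one point, and the slot of a point starts at [k *
theta < 1/2], so that the [k]-th point of the orbit of 0 is on the crest. *)
Lemma card_on_crest_le (R : realType) (theta y : R) (c : nat) :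
  0 < theta -> c%:R * theta <= 1 ->
  (#|on_crest theta y c| <= #|on_crest theta 0%R c|)%N.
Proof.
case: c => [|c] t0 ct.
  by rewrite [X in (X <= _)%N](_ : _ = 0)%N //; apply: eq_card0 => -[].
have crest0 (j : 'I_c.+1) : (j \in on_crest theta 0 c.+1) = (j%:R * theta < 2^-1).
  rewrite inE addr0 frac_part_id // mulr_ge0 ?(ltW t0) //=.
  by apply: lt_le_trans ct; rewrite ltr_pM2r // ltr_nat.
case: (ltP (c%:R * theta) 2^-1) => ch.
  rewrite [X in (_ <= X)%N](_ : _ = c.+1).
    by rewrite -[X in (_ <= X)%N]card_ord max_card.
  rewrite -[RHS]card_ord; apply: eq_card => j; rewrite crest0 inE.
  by apply: le_lt_trans ch; rewrite ler_pM2r // ler_nat -ltnS.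
(* Now the orbit of 0 leaves the crest before its end, so every slot number is
   the index of one of its points. *)
pose slot (j : 'I_c.+1) := `|Num.floor (frac_part (j%:R * theta + y) / theta)|%N.
have slotP (j : 'I_c.+1) : (slot j)%:R * theta <= frac_part (j%:R * theta + y)
    < ((slot j)%:R + 1) * theta.
  have /andP[f0 _] := frac_part_itv (j%:R * theta + y).
  rewrite -ler_pdivlMr // -ltr_pdivrMr //.
  have ge0 : 0 <= Num.floor (frac_part (j%:R * theta + y) / theta).
    by rewrite floor_ge0 divr_ge0 // ltW.
  have := floor_itv (frac_part (j%:R * theta + y) / theta).
  by rewrite intrD -(gez0_abs ge0) -/(slot j).
have slot_lt (j : 'I_c.+1) : j \in on_crest theta y c.+1 -> (slot j < c.+1)%N.
  rewrite inE => jc; have /andP[sj _] := slotP j.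
  have : (slot j)%:R * theta < c%:R * theta by apply: le_lt_trans sj _; lra.
  by rewrite ltr_pM2r // ltr_nat; lia.
pose f (j : 'I_c.+1) : 'I_c.+1 := inord (slot j).
have f_inj : {in on_crest theta y c.+1 &, injective f}.
  move=> i j ic jc /(congr1 val); rewrite /f /= !inordK ?slot_lt // => E.
  have /andP[] := slotP i; have /andP[] := slotP j; rewrite E => j1 j2 i1 i2.
  apply/val_inj; apply: contrapT => /eqP; rewrite neq_ltn => /orP[ij|ij].
    have := @frac_part_spacing R theta y c.+1 i j t0 ct _.
    by rewrite ij ltn_ord => /(_ isT); rewrite ler_normr => /orP[]; lra.
  have := @frac_part_spacing R theta y c.+1 j i t0 ct _.
  by rewrite ij ltn_ord => /(_ isT); rewrite ler_normr => /orP[]; lra.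
rewrite -(card_in_imset f_inj); apply/subset_leq_card/fintype.subsetP => k /imsetP[j jc ->].
rewrite crest0 /f inordK ?slot_lt //.
by have /andP[sj _] := slotP j; apply: le_lt_trans sj _; move: jc; rewrite inE.
Qed.

(** The upper bound is a count of points; the lower one follows by moving the
starting point by a half turn, which negates the wave. *)
Lemma wave_sum_max_at0 (R : realType) (theta y : R) (c : nat) :
  0 < theta -> c%:R * theta <= 1 ->
  `|wave_sum theta y c| <= `|wave_sum theta 0 c|.
Proof.
move=> t0 ct; apply: le_trans (ler_norm _).
have le_top z : wave_sum theta z c <= wave_sum theta 0 c.
  by rewrite !wave_sum_crest lerD2r ler_pM2l ?ltr0n // ler_nat card_on_crest_le.
have half : wave_sum theta (y + 2^-1) c = - wave_sum theta y c.
  rewrite /wave_sum -sumrN; apply: eq_bigr => j _.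
  by rewrite addrA square_wave_half.
by rewrite ler_norml lerNl -half !le_top.
Qed.

(** Reading the orbit backwards. *)
Lemma wave_sum_rev (R : realType) (theta y : R) (c : nat) :
  wave_sum (- theta) y c = wave_sum theta (y - (c%:R - 1) * theta) c.
Proof.
rewrite /wave_sum (reindex_inj rev_ord_inj) /=; apply: eq_bigr => j _.
congr square_wave; rewrite natrB ?ltn_ord // -addn1 natrD; lra.
Qed.

Lemma irrational_mul_neq (R : realType) (x : R) (a : int) (b : nat) :
  irrational x -> (0 < b)%N -> b%:R * x != a%:~R :> R.
Proof.
move=> irr; case: b => [//|b] _.
apply/eqP => E; apply: irr; apply/rationalP; exists a, b.+1.
by rewrite -E mulrAC divff ?mul1r // pnatr_eq0.
Qed.

(** Fails exactly at the jumps, where the wave takes its value from the right. *)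
Lemma square_wave_opp (R : realType) (x : R) : irrational x ->
  square_wave (- x) = - square_wave x.
Proof.
move=> irr; have /andP[f0 f1] := frac_part_itv x.
have fE : x = frac_part x + (Num.floor x)%:~R by rewrite /frac_part subrK.
have fn0 : frac_part x != 0.
  have /eqP h := irrational_mul_neq (Num.floor x) irr (ltn0Sn 0).
  by apply/eqP => f; apply: h; rewrite mul1r {1}fE f add0r.
have fnh : frac_part x != 2^-1.
  have /eqP h := irrational_mul_neq (2 * Num.floor x + 1) irr (ltn0Sn 1).
  by apply/eqP => f; apply: h; rewrite {1}fE f intrD intrM; lra.
have -> : - x = (1 - frac_part x) + (- (Num.floor x + 1))%:~R.
  by rewrite {1}fE intrN intrD; lra.
have f0' : 0 < frac_part x by rewrite lt_neqAle eq_sym fn0.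
rewrite square_wave_int !square_wave_crest frac_part_id; last by apply/andP; split; lra.
case: (ltrgtP (frac_part x) 2^-1) fnh => // h _.
- by rewrite (_ : (_ < _) = false) /=; [lra | apply/negbTE; rewrite -leNgt; lra].
- by rewrite (_ : (_ < _) = true) /=; lra.
Qed.

(** The orbits of 0 under opposite rotations mirror each other, apart from their
common starting point, which is a jump. *)
Lemma wave_sum_opp (R : realType) (theta : R) (c : nat) :
  irrational theta ->
  `|wave_sum (- theta) 0 c + wave_sum theta 0 c| <= 2.
Proof.
move=> irr; rewrite /wave_sum -big_split /=.
case: c => [|c]; first by rewrite big_ord0 normr0.
rewrite big_ord_recl big1 => [|j _]; last first.
  rewrite !addr0 mulrN square_wave_opp ?addNr //.
  move=> /rationalP[a [b E]]; apply: irr; apply/rationalP.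
  exists a, (b * (bump 0 j))%N.
  by rewrite natrM invfM mulrA -E mulrAC divff ?mul1r // pnatr_eq0.
rewrite addr0; apply: le_trans (ler_normD _ _) _.
by rewrite !square_wave_norm; lra.
Qed.

Lemma wave_sum_near_max_at0 (R : realType) (theta y : R) (c : nat) :
  irrational theta -> c%:R * `|theta| <= 1 ->
  `|wave_sum theta y c| <= `|wave_sum theta 0 c| + 2.
Proof.
move=> irr ct.
case: (ltrgtP theta 0) => t0.
- rewrite -[theta in leLHS]opprK wave_sum_rev.
  have h : c%:R * - theta <= 1 by move: ct; rewrite ltr0_norm.
  have t0' : 0 < - theta by lra.
  apply: le_trans (wave_sum_max_at0 _ t0' h) _.
  have := wave_sum_opp c irr.
  set A := wave_sum _ _ _; set B := wave_sum _ _ _ => AB.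
  rewrite -[A](addrK B); apply: le_trans (ler_normB _ _) _; lra.
- have h : c%:R * theta <= 1 by move: ct; rewrite gtr0_norm.
  by apply: le_trans (wave_sum_max_at0 _ t0 h) _; lra.
- by case: irr; rewrite t0 /rational /=; exists 0; rewrite ?rmorph0.
Qed.

(** * Convergents *)

Fixpoint cf_p (a : nat -> nat) (n : nat) : nat :=
  if n is n'.+1 then
    if n' is n''.+1 then (a n * cf_p a n' + cf_p a n'')%N else 1%N
  else 0%N.

(** The previous denominator and numerator, including the conventional values
[q_{-1} = 0] and [p_{-1} = 1]: with these the recurrences hold from the start. *)
Definition cf_q_pred (a : nat -> nat) (n : nat) : nat :=
  if n is n'.+1 then cf_q a n' else 0%N.

Definition cf_p_pred (a : nat -> nat) (n : nat) : nat :=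
  if n is n'.+1 then cf_p a n' else 1%N.

Lemma cf_qS a n : cf_q a n.+1 = (a n.+1 * cf_q a n + cf_q_pred a n)%N.
Proof. by case: n => [|n] //=; rewrite muln1 addn0. Qed.

Lemma cf_pS a n : cf_p a n.+1 = (a n.+1 * cf_p a n + cf_p_pred a n)%N.
Proof. by case: n => [|n] //=; rewrite muln0. Qed.

Lemma cf_q_gt0 a n : (forall h, (1 <= h)%N -> (0 < a h)%N) -> (0 < cf_q a n)%N.
Proof.
move=> a0; elim: n => [//|n IH]; rewrite cf_qS.
by rewrite ltn_addr // muln_gt0 a0.
Qed.

Lemma cf_det a n :
  (cf_q a n * cf_p_pred a n = cf_p a n * cf_q_pred a n + 1)%N \/
  (cf_q a n * cf_p_pred a n + 1 = cf_p a n * cf_q_pred a n)%N.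
Proof.
elim: n => [|n IH]; first by left.
by rewrite cf_qS cf_pS /=; case: IH => IH; [right|left]; nia.
Qed.

Lemma coprime_cf a n : coprime (cf_q a n) (cf_p a n).
Proof.
rewrite /coprime -dvdn1.
have dq := dvdn_gcdl (cf_q a n) (cf_p a n); have dp := dvdn_gcdr (cf_q a n) (cf_p a n).
have [E|E] := cf_det a n.
- by rewrite -(dvdn_addr 1 (dvdn_mulr (cf_q_pred a n) dp)) -E dvdn_mulr.
- by rewrite -(dvdn_addr 1 (dvdn_mulr (cf_p_pred a n) dq)) E dvdn_mulr.
Qed.

Lemma finite_cf_ge0 (R : realType) (s : seq nat) : 0 <= finite_cf R s.
Proof. by elim: s => [|x s IH] //=; rewrite invr_ge0 addr_ge0. Qed.

(** A prefix of a continued fraction acts on the value of its tail as a Moebius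
transformation. *)
Lemma finite_cf_cat (R : realType) (a : nat -> nat) (n : nat) (s : seq nat) :
  (forall h, (1 <= h)%N -> (0 < a h)%N) ->
  finite_cf R ([seq a h | h <- iota 1 n] ++ s)
  = ((cf_p a n)%:R + (cf_p_pred a n)%:R * finite_cf R s)
    / ((cf_q a n)%:R + (cf_q_pred a n)%:R * finite_cf R s).
Proof.
move=> a0; elim: n s => [|n IH] s.
  by rewrite /= mul0r addr0 divr1 add0r mul1r.
have -> : [seq a h | h <- iota 1 n.+1] ++ s = [seq a h | h <- iota 1 n] ++ a n.+1 :: s.
  by rewrite -[in LHS](addn1 n) iotaD map_cat -catA /= add1n.
rewrite IH cf_pS cf_qS [finite_cf R (_ :: _)]/=.
rewrite -[cf_q_pred a n.+1]/(cf_q a n) -[cf_p_pred a n.+1]/(cf_p a n).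
have t0 := finite_cf_ge0 R s; set t := finite_cf R s in t0 *.
have an0 : 0 < (a n.+1)%:R :> R by rewrite ltr0n a0.
have q0 : 0 < (cf_q a n)%:R :> R by rewrite ltr0n cf_q_gt0.
have qp0 : 0 <= (cf_q_pred a n)%:R :> R by [].
rewrite !natrD !natrM.
set A := (a n.+1)%:R in an0 *; set Q := (cf_q a n)%:R in q0 *.
set Q' := (cf_q_pred a n)%:R in qp0 *.
have h1 : A + t != 0 by rewrite gt_eqF // ltr_pwDl.
have h2 : A * Q + Q' + Q * t != 0.
  by rewrite gt_eqF // -addrA ltr_pwDl ?mulr_gt0 // addr_ge0 // mulr_ge0 // ltW.
by field; rewrite h2 h1.
Qed.

(** If [t] is the tail after [h] terms, the determinant identity gives the error
[t / (q + q_pred * t)], where [t <= 1 / a_{h+1}] because the tail is nonempty. *)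
Lemma finite_cf_approx (R : realType) (a : nat -> nat) (h m : nat) :
  (forall h, (1 <= h)%N -> (0 < a h)%N) -> (h < m)%N ->
  (cf_q a h.+1)%:R * `|(cf_q a h)%:R * cf_convergent R a m - (cf_p a h)%:R| <= 1.
Proof.
move=> a0 hm; rewrite /cf_convergent.
have -> : m = (h + (m - h.+1).+1)%N by lia.
rewrite iotaD map_cat finite_cf_cat // add1n [map _ (iota _ _.+1)]/= [finite_cf R (_ :: _)]/=.
set t' := finite_cf R _; have t'0 : 0 <= t' by exact: finite_cf_ge0.
set t := (_ + t')^-1.
have A0 : 0 < (a h.+1)%:R :> R by rewrite ltr0n a0.
have t0 : 0 <= t by rewrite invr_ge0 addr_ge0 // ltW.
have tA : t * (a h.+1)%:R <= 1.
  by rewrite /t mulrC ler_pdivrMr ?mul1r ?lerDl // ltr_pwDl.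
have q0 : 0 < (cf_q a h)%:R :> R by rewrite ltr0n cf_q_gt0.
have d0 : 0 < (cf_q a h)%:R + (cf_q_pred a h)%:R * t :> R.
  by rewrite ltr_pwDl // mulr_ge0.
have -> : (cf_q a h)%:R * (((cf_p a h)%:R + (cf_p_pred a h)%:R * t)
      / ((cf_q a h)%:R + (cf_q_pred a h)%:R * t)) - (cf_p a h)%:R
   = ((cf_q a h * cf_p_pred a h)%N%:R - (cf_p a h * cf_q_pred a h)%N%:R) * t
      / ((cf_q a h)%:R + (cf_q_pred a h)%:R * t) :> R.
  by rewrite !natrM; field; rewrite gt_eqF.
have -> : `|((cf_q a h * cf_p_pred a h)%N%:R - (cf_p a h * cf_q_pred a h)%N%:R) * t
      / ((cf_q a h)%:R + (cf_q_pred a h)%:R * t)|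
   = t / ((cf_q a h)%:R + (cf_q_pred a h)%:R * t) :> R.
  rewrite normrM (normrM _ t) (ger0_norm t0) normfV (gtr0_norm d0).
  suff -> : `|(cf_q a h * cf_p_pred a h)%N%:R - (cf_p a h * cf_q_pred a h)%N%:R| = 1 :> R.
    by rewrite mul1r.
  case: (cf_det a h) => [->|<-]; rewrite natrD.
  - by rewrite addrC addKr normr1.
  - by rewrite opprD addNKr normrN1.
rewrite mulrA ler_pdivrMr // mul1r cf_qS natrD natrM.
have := ler_wpM2r (ltW q0) tA; lra.
Qed.

Lemma cf_approx (R : realType) (alpha : R) (a : nat -> nat) (h : nat) :
  is_cf_expansion a alpha ->
  (cf_q a h.+1)%:R * `|(cf_q a h)%:R * alpha - (cf_p a h)%:R| <= 1.
Proof.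
move=> [a0 /cvgrPdist_lt cv]; apply/ler_addgt0Pr => e e0.
set Q := (cf_q a h.+1)%:R; set q := (cf_q a h)%:R; set p := (cf_p a h)%:R.
have Q0 : 0 < Q :> R by rewrite ltr0n cf_q_gt0.
have q0 : 0 < q :> R by rewrite ltr0n cf_q_gt0.
have e0' : 0 < e / (Q * q) by rewrite divr_gt0 // mulr_gt0.
have [M _ HM] := cv _ e0'.
have := HM (maxn M h.+1) (leq_maxl _ _); set m := maxn M h.+1 => close.
have hm : (h < m)%N by rewrite leq_maxr.
have := finite_cf_approx R a0 hm; rewrite -/Q -/q -/p; set C := cf_convergent R a m in close *.
move=> bnd; have -> : q * alpha - p = q * (alpha - C) + (q * C - p) by ring.
apply: le_trans (ler_wpM2l (ltW Q0) (ler_normD _ _)) _.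
rewrite normrM (gtr0_norm q0) mulrDr mulrA addrC lerD //.
by rewrite mulrC -ler_pdivlMr ?mulr_gt0 // ltW.
Qed.

(** * Ostrowski digits *)

Lemma wave_sumD (R : realType) (theta y : R) (k l : nat) :
  wave_sum theta y (k + l)
  = wave_sum theta y k + wave_sum theta (k%:R * theta + y) l.
Proof.
rewrite /wave_sum big_split_ord /=; congr (_ + _); apply: eq_bigr => j _.
by rewrite natrD mulrDl [in RHS]addrA [in RHS](addrC (j%:R * theta)).
Qed.

Lemma wave_sum_le_size (R : realType) (theta y : R) (k : nat) :
  `|wave_sum theta y k| <= k%:R.
Proof.
apply: le_trans (ler_norm_sum _ _ _) _.
under eq_bigr => j _ do rewrite square_wave_norm.
by rewrite sumr_const card_ord.
Qed.

Lemma cf_drift (R : realType) (alpha : R) (a : nat -> nat) (h c : nat) :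
  is_cf_expansion a alpha -> (c <= a h.+1)%N ->
  (c * cf_q a h)%N%:R * `|(cf_q a h)%:R * alpha - (cf_p a h)%:R| <= 1.
Proof.
move=> alpha_cf ca; apply: le_trans (cf_approx h alpha_cf).
rewrite ler_wpM2r // ler_nat cf_qS.
by apply: leq_trans (leq_addr _ _); rewrite leq_mul2r ca orbT.
Qed.

Lemma wave_sum_block_le_count (R : realType) (alpha : R) (a : nat -> nat) (h c : nat)
    (b : R) :
  is_cf_expansion a alpha -> (c <= a h.+1)%N ->
  `|wave_sum alpha b (c * cf_q a h)| <= 2 + c%:R.
Proof.
move=> alpha_cf ca.
have := wave_sum_renorm b (cf_q_gt0 h alpha_cf.1) (coprime_cf a h) (cf_drift alpha_cf ca).
set A := wave_sum alpha b _; set B := (if _ then _ else _) => AB.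
rewrite -[A](subrK B); apply: le_trans (ler_normD _ _) _; apply: lerD => //.
by rewrite /B; case: ifP => _; [exact: wave_sum_le_size | rewrite normr0].
Qed.

(** The Denjoy-Koksma bound: a single block renormalises to one value of the wave,
or to zero. *)
Lemma wave_sum_cf_q (R : realType) (alpha : R) (a : nat -> nat) (h : nat) (b : R) :
  is_cf_expansion a alpha -> `|wave_sum alpha b (cf_q a h)| <= 3.
Proof.
move=> alpha_cf; rewrite -[cf_q a h]mul1n.
apply: le_trans (wave_sum_block_le_count _ alpha_cf _) _; last by lra.
exact: alpha_cf.1.
Qed.

(** The average of two bounds: [2 + c], good for small digits, and
[3 + 3 + (2 + (a - c))], good for digits near [a], obtained by completing the
blocks to the next denominator. *)
Lemma wave_sum_level (R : realType) (alpha : R) (a : nat -> nat) (h c : nat) (b : R) :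
  is_cf_expansion a alpha -> (c <= a h.+1)%N ->
  `|wave_sum alpha b (c * cf_q a h)| <= 5 + (a h.+1)%:R / 2.
Proof.
move=> alpha_cf ca; have low := wave_sum_block_le_count b alpha_cf ca.
have E : cf_q a h.+1 = (c * cf_q a h + ((a h.+1 - c) * cf_q a h + cf_q_pred a h))%N.
  by rewrite cf_qS addnA -mulnDl subnKC.
have := wave_sum_cf_q h.+1 b alpha_cf; rewrite E !wave_sumD.
set x := _ + b; set y := _ + x.
have rest := wave_sum_block_le_count x alpha_cf (leq_subr c (a h.+1)).
have prev : `|wave_sum alpha y (cf_q_pred a h)| <= 3.
  case: (h) => [|k]; last exact: wave_sum_cf_q.
  by rewrite /wave_sum big_ord0 normr0.
rewrite natrB // in rest; move: low rest prev.
set A := wave_sum _ _ _; set B := wave_sum _ _ _; set C := wave_sum _ _ _.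
move=> low rest prev tot.
have : `|A| <= `|A + (B + C)| + (`|B| + `|C|).
  rewrite -{1}[A](addrK (B + C)); apply: le_trans (ler_normB _ _) _.
  by rewrite lerD2l ler_normD.
by lra.
Qed.

Lemma wave_sum_ostrowski (R : realType) (alpha : R) (a : nat -> nat) (c : nat -> nat)
    (M : nat) (b : R) :
  is_cf_expansion a alpha ->
  (forall h, (h < M)%N -> (c h <= a h.+1)%N) ->
  `|wave_sum alpha b (\sum_(h < M) c h * cf_q a h)%N|
  <= \sum_(h < M) (5 + (a h.+1)%:R / 2).
Proof.
move=> alpha_cf; elim: M b => [|M IH] b ca.
  by rewrite !big_ord0 /wave_sum big_ord0 normr0.
rewrite !big_ord_recr /= wave_sumD; apply: le_trans (ler_normD _ _) _.
apply: lerD; first by apply: IH => h hM; apply: ca; rewrite ltnW.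
exact/wave_sum_level/ca/ltnSn.
Qed.

(** Renormalisation costs 2 at [b] and 2 at 0; the comparison of the short sums
costs 2 more, for a leftward drift. *)
Lemma wave_sum_block_near0 (R : realType) (alpha : R) (a : nat -> nat) (h c : nat)
    (b : R) :
  is_cf_expansion a alpha -> irrational alpha -> (c <= a h.+1)%N ->
  `|wave_sum alpha b (c * cf_q a h)| <= `|wave_sum alpha 0 (c * cf_q a h)| + 6.
Proof.
move=> alpha_cf irr ca; have qh0 := cf_q_gt0 h alpha_cf.1.
have renorm y := wave_sum_renorm y qh0 (coprime_cf a h) (cf_drift alpha_cf ca).
have := renorm b; have := renorm 0; rewrite mulr0.
case: ifP => _; last first.
  rewrite !subr0 => _; have := normr_ge0 (wave_sum alpha 0 (c * cf_q a h)).
  by lra.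
set theta := _ * (_ - _).
have q0 : (cf_q a h)%:R != 0 :> R by rewrite pnatr_eq0 -lt0n.
have irrt : irrational theta.
  move=> [z _ E]; apply: irr.
  exists ((z / (cf_q a h)%:R + (cf_p a h)%:R) / (cf_q a h)%:R) => //.
  rewrite fmorph_div rmorphD fmorph_div !rmorph_nat /= E /theta.
  by field.
have ct : c%:R * `|theta| <= 1.
  by rewrite normrM mulrA normr_nat -natrM cf_drift.
have := wave_sum_near_max_at0 ((cf_q a h)%:R * b) irrt ct.
set A := wave_sum alpha 0 _; set B := wave_sum alpha b _.
set X := wave_sum theta 0 _; set Y := wave_sum theta _ _.
move=> YX AX BY.
have : `|B| <= `|B - Y| + `|Y| by rewrite -{1}[B](subrK Y) ler_normD.
have : `|X| <= `|A| + `|A - X| by rewrite -{1}[X](subKr A) ler_normB.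
by lra.
Qed.

(** The last term of the orbit is kept apart because the digits of [n] account for
[n] terms only. *)
Lemma wave_sum_compare (R : realType) (alpha : R) (a : nat -> nat) (n N : nat)
    (c : nat -> nat) (b : R) :
  is_cf_expansion a alpha -> irrational alpha -> (0 < N)%N -> ostrowski_rep a n N c ->
  `|wave_sum alpha b n.+1| <= `|wave_sum alpha 0 n.+1|
     + \sum_(h < N) (18 + 3 / 2 * (a h.+1)%:R).
Proof.
move=> alpha_cf irr N0 [nE c0 ch _ _].
have ca h : (h <= N)%N -> (c h <= a h.+1)%N.
  by case: h => [|h] hN; [exact: ltnW | apply: ch].
rewrite big_nat_recr //= big_mkord in nE.
set L := (\sum_(h < N) _)%N in nE.
(* The leading digit comes first in time, so that at [b = 0] its block starts at
   0 as well. *)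
have -> : n.+1 = (c N * cf_q a N + (L + 1))%N by rewrite nE; lia.
rewrite !wave_sumD.
have low y : `|wave_sum alpha y L| <= \sum_(h < N) (5 + (a h.+1)%:R / 2).
  by apply: (wave_sum_ostrowski _ alpha_cf) => h hN; apply: ca; rewrite ltnW.
have one y : `|wave_sum alpha y 1| <= 1 := wave_sum_le_size _ _ 1.
have top := wave_sum_block_near0 b alpha_cf irr (ca N (leqnn N)).
have total : 2 * (\sum_(h < N) (5 + (a h.+1)%:R / 2)) + 8
    <= \sum_(h < N) (18 + 3 / 2 * (a h.+1)%:R) :> R.
  apply: (@le_trans _ _ (\sum_(h < N) (2 * (5 + (a h.+1)%:R / 2) + 8))).
    rewrite [leRHS]big_split /= mulr_sumr lerD2l sumr_const card_ord.
    by rewrite -(mulr_natr 8 N) ler_peMr // ler1n.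
  by apply: ler_sum => h _; have := ler0n R (a h.+1); lra.
set x := _ + b; set x0 := _ + 0; set y := _ + x; set y0 := _ + x0.
have := low x; have := low x0; have := one y; have := one y0.
set A := wave_sum alpha b _ in top *; set A0 := wave_sum alpha 0 _ in top *.
set B := wave_sum alpha x _; set B0 := wave_sum alpha x0 _.
set C := wave_sum alpha y _; set C0 := wave_sum alpha y0 _.
move=> hC0 hC hB0 hB.
have hA : `|A + (B + C)| <= `|A| + (`|B| + `|C|).
  by apply: le_trans (ler_normD _ _) _; rewrite lerD2l ler_normD.
have hA0 : `|A0| <= `|A0 + (B0 + C0)| + (`|B0| + `|C0|).
  rewrite -{1}[A0](addrK (B0 + C0)); apply: le_trans (ler_normB _ _) _.
  by rewrite lerD2l ler_normD.
by lra.
Qed.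

Theorem corollary4p5 (R : realType) (alpha : R) (a : nat -> nat) (n N : nat)
    (alpha_irr : irrational alpha) (alpha01 : 0 < alpha < 1)
    (alpha_cf : is_cf_expansion a alpha)
    (n_ge1 : (1 <= n)%N) (ord_n : has_ord a n N) :
  sup [set `|birkhoff_sum n alpha beta| | beta in (`]0, 1[%classic : set R)]
  <= `|birkhoff_sum n alpha 0|
     + 6 * \sum_(1 <= m < N.+1) (3 + (a m)%:R / 4).
Proof.
have waveE b : birkhoff_sum n alpha b = wave_sum alpha b n.+1.
  by rewrite /birkhoff_sum big_mkord.
apply: ge_sup.
  exists `|birkhoff_sum n alpha 2^-1|; exists 2^-1 => //=.
  by rewrite in_itv /=; lra.
move=> _ [b _ <-]; rewrite !waveE big_add1 big_mkord mulr_sumr.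
have [c rep] := ord_n; case: (posnP N) => [N0|N_gt0].
  (* The whole orbit is one short sum, so [alpha] itself plays the part of the
     drift. *)
  rewrite N0 big_ord0 addr0; have /andP[al0 _] := alpha01.
  apply: wave_sum_max_at0 => //.
  have na : (n < a 1)%N.
    by case: rep => nE ca _ _ _; rewrite nE N0 big_nat1 muln1.
  have := cf_approx 0 alpha_cf; rewrite /= mul1r subr0 gtr0_norm //.
  by apply: le_trans; rewrite ler_wpM2r ?(ltW al0) // ler_nat.
apply: le_trans (wave_sum_compare b alpha_cf alpha_irr N_gt0 rep) _.
by rewrite lerD2l; apply: ler_sum => h _; lra.
Qed.
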